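(* Let $K$ be a compact set in the real Hilbert space $H$, and suppose that there exists $e\in H$ such that (i) $\langle k,e\rangle>0$ for all $k\in K$, and (ii) $\dim K=n$. Let $C$ be the closed convex cone defined by $$C:=-K^\ominus=\{y\in H\mid \langle y,k\rangle\ge 0\text{ for all }k\in K\}.$$ Let $x\in H\setminus C$ and $x_0\in C$. Then the following statements are equivalent: (1) $x_0=P_C(x)$; (2) $x_0=x+\sum_{i=1}^m\rho_i k_i$, where $1\le m\le n$, $\rho_i>0$ and $k_i\in K$ for $i=1,2,\dots,m$, the vectors $k_1,k_2,\dots,k_m$ are linearly independent, and $\langle k_i,x_0\rangle=0$ for $i=1,2,\dots,m$. Moreover, if $\dim H=n$ and $x_0\ne 0$ in any of the two statements, then $m\le n-1$.
   Context: All spaces are real. $\dim K=n$ means that a maximal linearly independent subset of $K$ has $n$ elements. For $S\subset H$, $S^\ominus:=\{x\in H\mid\langle x,y\rangle\le 0\text{ for all }y\in S\}$. For a nonempty closed convex set $C\subset H$ and $x\in H$, $P_C(x)$ is the unique best approximation (nearest point) to $x$ in $C$. *)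

(* Defs.v *)
From HB Require Import structures.
From mathcomp Require Import all_boot all_order all_algebra.
From mathcomp Require Import all_classical all_reals all_analysis.

Set Implicit Arguments.
Unset Strict Implicit.
Unset Printing Implicit Defensive.

Import Order.TTheory GRing.Theory Num.Theory.
Import numFieldNormedType.Exports.
Local Open Scope classical_set_scope.
Local Open Scope ring_scope.

(* The space H is not assumed to be finite-dimensional, so [free] from vector.v,
   which requires a vectType, is not available. *)
Definition lin_indep_family (R : fieldType) (V : lmodType R) (m : nat)
    (v : 'I_m -> V) : Prop :=
  forall c : 'I_m -> R, \sum_(i < m) c i *: v i = 0 -> forall i, c i = 0.

Definition lin_indep_set (R : fieldType) (V : lmodType R) (B : set V) : Prop :=
  forall (m : nat) (v : 'I_m -> V),
    injective v -> (forall i, B (v i)) -> lin_indep_family v.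

Definition maximal_lin_indep (R : fieldType) (V : lmodType R)
    (S B : set V) : Prop :=
  [/\ B `<=` S, lin_indep_set B &
      forall B' : set V,
        B' `<=` S -> lin_indep_set B' -> B `<=` B' -> B' = B].

(* [S] is an arbitrary subset, not necessarily a subspace. *)
Definition has_dim (R : fieldType) (V : lmodType R) (S : set V) (n : nat) :
    Prop :=
  exists B : set V, maximal_lin_indep S B /\ (B #= `I_n)%card.

Definition polar_cone (R : realType) (H : normedModType R)
    (ip : {dot H for idfun}) (S : set H) : set H :=
  [set x | forall y, S y -> ip x y <= 0].

Definition neg_polar_cone (R : realType) (H : normedModType R)
    (ip : {dot H for idfun}) (S : set H) : set H :=
  [set - z | z in polar_cone ip S].

Lemma neg_polar_coneE (R : realType) (H : normedModType R)
    (ip : {dot H for idfun}) (S : set H) :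
  neg_polar_cone ip S = [set y | forall k, S k -> 0 <= ip y k].
Proof.
apply/seteqP; split=> [_ [z zS <-] k Sk|y yS] /=.
  by rewrite linearNl oppr_ge0; exact: zS.
exists (- y); last by rewrite opprK.
by move=> k Sk; rewrite linearNl oppr_le0; exact: yS.
Qed.

Definition best_approx (R : realType) (H : normedModType R) (C : set H)
    (x : H) : set H :=
  [set p | C p /\ forall y, C y -> `|x - p| <= `|x - y|].

(* The default value 0 is returned only when there is no best approximation,
   which cannot happen if C is a nonempty closed convex subset of a Hilbert
   space; in that case the best approximation is also unique. *)
Definition metric_proj (R : realType) (H : normedModType R) (C : set H)
    (x : H) : H :=
  xget 0 (best_approx C x).

(* Main.v *)
Require Import Defs.
From mathcomp Require Import all_boot all_order all_algebra.
From mathcomp Require Import all_classical all_reals all_analysis.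
From mathcomp Require Import ring lra.

Import Order.TTheory GRing.Theory Num.Theory.
Import numFieldNormedType.Exports.
Local Open Scope classical_set_scope.
Local Open Scope ring_scope.

(** The theorem is Moreau's decomposition of [x] along [C] and its polar cone
[- cone K], where [cone K] is the set of conic combinations of points of [K].

If [p = x + \sum_i rho i *: k i] lies in [C] with the [k i] orthogonal to [p],
then every [y] in [C] satisfies [ip (x - p) (y - p) <= 0], because [x - p] is
minus a conic combination of the [k i] and [ip (k i) y >= 0 = ip (k i) p].
Expanding [`|x - y| ^+ 2] around [p] makes [p] the only nearest point of [C]
to [x] ([metric_proj_conic_complement]).

For the converse it therefore suffices to produce one [p] of that shape.
Minimise [`|x + w|] over [w] in [cone K] and put [p = x + w].  Moving [w] in
the direction of a point [k] of [K] gives [0 <= ip k p], that is, [p] is in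
[C]; shrinking [w] gives [ip w p <= 0], so all the nonnegative terms of
[ip w p] vanish and the points of [K] used in [w] are orthogonal to [p]
([conic_hull_min_dual]).

The minimum exists because [cone K] reduces to a compact family.  Carathéodory's
theorem ([caratheodory]) writes a conic combination with linearly independent
points of [K], of which there are at most [n] ([has_dim_leq]).  The vector [e]
is positive on the compact set [K], hence bounded below there by some [d > 0],
and so [d * \sum_i rho i <= ip w e], which bounds the coefficients as soon as
[`|x + w| <= `|x|].  What remains is the minimum of a continuous function on a
power of [`[0, M] `*` K] ([conic_comb_norm_min]).  The same use of Carathéodory
makes the representation of the minimiser linearly independent.

Finally, if [p] is nonzero it can be added to the [k i], to which it is
orthogonal, without losing independence ([lin_indep_family_orthogonal]); in
dimension [n] this leaves room for only [n.-1] vectors [k i]. *)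

(** * Linear independence and dimension of sets *)

Section Span.
Context {F : fieldType} {V : lmodType F}.
Implicit Types (S B : set V).

Definition in_span {n} (b : 'I_n -> V) (z : V) : Prop :=
  exists a : 'I_n -> F, z = \sum_(j < n) a j *: b j.

Lemma in_span_gen {n} (b : 'I_n -> V) j : in_span b (b j).
Proof.
exists (fun i => (i == j)%:R); rewrite (bigD1 j) //= eqxx scale1r big1 ?addr0//.
by move=> i /negPf ->; rewrite scale0r.
Qed.

Lemma in_span_sum {n} (b : 'I_n -> V) m (c : 'I_m -> F) (v : 'I_m -> V) :
  (forall i, in_span b (v i)) -> in_span b (\sum_(i < m) c i *: v i).
Proof.
move=> /choice[A vE]; exists (fun j => \sum_(i < m) c i * A i j).
under [RHS]eq_bigr do rewrite scaler_suml.
rewrite exchange_big /=; apply: eq_bigr => i _.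
by rewrite vE scaler_sumr; apply: eq_bigr => j _; rewrite scalerA.
Qed.

Lemma in_spanZ {n} (b : 'I_n -> V) (a : F) (z : V) :
  in_span b z -> in_span b (a *: z).
Proof.
move=> bz.
by have := in_span_sum b 1 (fun=> a) (fun=> z) (fun=> bz); rewrite big_ord1.
Qed.

(** Steinitz: the coordinates of [v] on [b] form a matrix with more rows than
columns when [n < m], and a nonzero row vector of its kernel is a linear
relation between the [v i]. *)
Lemma lin_indep_family_leq {n} (b : 'I_n -> V) {m} (v : 'I_m -> V) :
  lin_indep_family v -> (forall i, in_span b (v i)) -> (m <= n)%N.
Proof.
move=> v_indep /choice[A vE]; rewrite leqNgt; apply/negP => ltnm.
pose M := \matrix_(i < m, j < n) A i j.
have : kermx M != 0.
  by rewrite kermx_eq0 /row_free ltn_eqF// (leq_ltn_trans (rank_leq_col _)).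
case/rowV0Pn => u /sub_kermxP uM /negP; apply.
apply/eqP/rowP => i; rewrite mxE.
apply: (v_indep (u 0)) i.
under eq_bigr do rewrite vE scaler_sumr.
rewrite exchange_big /= big1// => j _.
under eq_bigr do rewrite scalerA.
rewrite -scaler_suml.
have -> : \sum_(i < m) u 0 i * A i j = (u *m M) 0 j.
  by rewrite mxE; apply: eq_bigr => i _; rewrite mxE.
by rewrite uM mxE scale0r.
Qed.

(** If [z] were outside the span, adding it to the independent set would keep it
independent: in a relation that involves [z], its coefficient must vanish,
since otherwise the relation can be solved for [z].  This contradicts
maximality. *)
Lemma maximal_lin_indep_span S n (b : 'I_n -> V) :
  maximal_lin_indep S (range b) -> forall z, S z -> in_span b z.
Proof.
move=> [bS b_indep b_max] z Sz; apply: contrapT => zNb.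
have bN i : z <> b i by move=> zb; apply: zNb; rewrite zb; exact: in_span_gen.
have : z |` range b = range b.
  apply: b_max => [y [->//|/bS//]| |y]; last by right.
  move=> m v v_inj vB c cv0.
  have [[j vj]|vNz] := pselect (exists j, v j = z); last first.
    apply: (b_indep m v v_inj) => // i.
    by have [viz|//] := vB i; case: vNz; exists i.
  have vlift i : range b (v (lift j i)).
    have [|//] := vB (lift j i); rewrite -vj => /v_inj ji.
    by have := neq_lift j i; rewrite ji eqxx.
  move: cv0; rewrite (bigD1_ord j)//= vj => cv0.
  have cj0 : c j = 0.
    apply/eqP; apply: contra_notT zNb => cj.
    have -> : z = (- (c j)^-1) *: \sum_(i < m.-1) c (lift j i) *: v (lift j i).
      apply: (scalerI cj); rewrite scalerA mulrN divff// scaleN1r.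
      by apply/eqP; rewrite -addr_eq0 cv0.
    apply/in_spanZ/in_span_sum => i; have [l _ <-] := vlift i.
    exact: in_span_gen.
  move: cv0; rewrite cj0 scale0r add0r => cv0.
  have clift := b_indep _ (v \o lift j) (inj_comp v_inj lift_inj) vlift _ cv0.
  by move=> i; have [l ->|->//] := unliftP j i; exact: clift.
move=> /seteqP[/(_ z (or_introl erefl))[i _ /esym/bN]].
by [].
Qed.

Lemma has_dim_leq {S n m} {v : 'I_m -> V} :
  has_dim S n -> lin_indep_family v -> (forall i, S (v i)) -> (m <= n)%N.
Proof.
move=> [B [B_max /card_set_bijP[f [fI f_inj f_surj]]]] v_indep Sv.
have /choice[b bP] (i : 'I_n) : exists y, B y /\ f y = i.
  by have [y By fy] := f_surj i (ltn_ord i); exists y.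
have BE : B = range b.
  apply/seteqP; split=> [y By|_ [i _ <-]]; last exact: (bP i).1.
  exists (Ordinal (fI y By)) => //.
  by apply: f_inj; rewrite ?inE ?(bP _).2//; exact: (bP _).1.
apply: (lin_indep_family_leq b v v_indep) => i.
by apply: (maximal_lin_indep_span S) (Sv i); rewrite -BE.
Qed.

End Span.

(** * Conic combinations and Carathéodory's theorem *)

Section ConicHull.
Context {R : realFieldType} {V : lmodType R} (K : set V).

Definition conic_comb (n : nat) : set V :=
  [set z | exists (rho : 'I_n -> R) (k : 'I_n -> V),
    (forall i, 0 <= rho i /\ K (k i)) /\ z = \sum_(i < n) rho i *: k i].

Definition conic_hull : set V := \bigcup_n conic_comb n.

Lemma conic_combD n z (t : R) k :
  conic_comb n z -> 0 <= t -> K k -> conic_comb n.+1 (z + t *: k).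
Proof.
move=> [rho [l [rhol ->]]] t0 Kk.
exists (fun i => oapp rho t (unlift ord0 i)).
exists (fun i => oapp l k (unlift ord0 i)); split=> [i|].
  by case: unliftP => [j|] _ /=.
rewrite big_ord_recl unlift_none /= addrC; congr (_ + _).
by apply: eq_bigr => i _; rewrite liftK.
Qed.

Lemma conic_combZ n z (t : R) : conic_comb n z -> 0 <= t -> conic_comb n (t *: z).
Proof.
move=> [rho [k [rhok ->]]] t0; exists (fun i => t * rho i), k; split=> [i|].
  by have [rho0 ?] := rhok i; rewrite mulr_ge0.
by rewrite scaler_sumr; apply: eq_bigr => i _; rewrite scalerA.
Qed.

(** Zero terms pad a combination; they need some point of [K] to carry the
coefficient [0]. *)
Lemma conic_comb_widen m n : K !=set0 -> (m <= n)%N ->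
  conic_comb m `<=` conic_comb n.
Proof.
move=> [k Kk] /subnK <- z; elim: (n - m)%N => // d IH /IH zd.
by rewrite addSn -(addr0 z) -(scale0r k); exact: conic_combD.
Qed.

Lemma conic_comb_drop n (rho : 'I_n -> R) (k : 'I_n -> V) j :
  (forall i, 0 <= rho i /\ K (k i)) -> rho j = 0 ->
  conic_comb n.-1 (\sum_(i < n) rho i *: k i).
Proof.
move=> rhok rhoj; exists (rho \o lift j), (k \o lift j); split=> [i|].
  exact: rhok.
by rewrite (bigD1_ord j)//= rhoj scale0r add0r.
Qed.

(** Subtracting a multiple [t] of a linear relation [c] does not change the sum.
The largest [t] that keeps all coefficients nonnegative, namely the least ratio
[rho i / c i] over the positive [c i], makes one of them vanish. *)
Lemma conic_comb_dependent n (rho : 'I_n -> R) (k : 'I_n -> V) :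
  (forall i, 0 <= rho i /\ K (k i)) -> ~ lin_indep_family k ->
  conic_comb n.-1 (\sum_(i < n) rho i *: k i).
Proof.
move=> rhok /existsNP[c /not_implyP[ck /existsNP[l /eqP cl]]].
(* The relation may be negated, so it has a positive coefficient. *)
wlog cl_gt0 : c ck cl / 0 < c l.
  move=> gen; have [cl0|cl0] := ltP 0 (c l); first exact: (gen c).
  apply: (gen (\- c)) => //=; rewrite ?oppr_eq0// ?oppr_gt0 ?lt_neqAle ?cl//.
  by under eq_bigr do rewrite scaleNr; rewrite sumrN ck oppr0.
have [j cj_gt0 j_min] :=
  @arg_minP _ _ _ l (fun i => 0 < c i) (fun i => rho i / c i) cl_gt0.
pose t := rho j / c j.
have t_ge0 : 0 <= t by apply: divr_ge0 (ltW cj_gt0); exact: (rhok j).1.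
have -> : \sum_(i < n) rho i *: k i = \sum_(i < n) (rho i - t * c i) *: k i.
  under [RHS]eq_bigr do rewrite scalerBl -scalerA.
  by rewrite sumrB -scaler_sumr ck scaler0 subr0.
apply: (@conic_comb_drop _ _ _ j) => [i|]; last first.
  by rewrite divfK ?subrr// gt_eqF.
split; last exact: (rhok i).2.
rewrite subr_ge0; have [ci|ci] := ltP 0 (c i).
  by rewrite -ler_pdivlMr//; exact: j_min.
by rewrite (@le_trans _ _ 0)//; [rewrite mulr_ge0_le0|exact: (rhok i).1].
Qed.

(** A representation with the least number of terms has no zero coefficient and
no linear relation, since either one would allow a shorter representation. *)
Lemma caratheodory z : conic_hull z ->
  exists m (rho : 'I_m -> R) (k : 'I_m -> V),
    [/\ forall i, 0 < rho i /\ K (k i), lin_indep_family k &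
        z = \sum_(i < m) rho i *: k i].
Proof.
move=> [n0 _ zn0].
have ex_n : exists n, `[< conic_comb n z >] by exists n0; apply/asboolP.
case: (ex_minnP ex_n) => m /asboolP[rho [k [rhok zE]]] m_min.
have stuck : (0 < m)%N -> ~ conic_comb m.-1 z.
  by move=> m_gt0 /asboolP/m_min; rewrite leqNgt ltn_predL m_gt0.
have rho_gt0 i : 0 < rho i.
  rewrite lt_neqAle (rhok i).1 andbT eq_sym; apply/eqP => rho0.
  apply: stuck; first by case: m i {m_min rhok zE rho0 rho k} => [[]|].
  by rewrite zE; exact: conic_comb_drop rho0.
exists m, rho, k; split=> //; first by move=> i; split=> //; exact: (rhok i).2.
case: m => [|m] in rho k rhok zE m_min stuck rho_gt0 *; first by move=> c _ [].
apply: contrapT => k_dep; apply: (stuck isT).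
by rewrite zE; exact: conic_comb_dependent.
Qed.

End ConicHull.

(** * Norm and inner product *)

Lemma continuous_sum_ord {R : numFieldType} {H : normedModType R}
    {T : topologicalType} n (g : 'I_n -> T -> H) :
  (forall i, continuous (g i)) -> continuous (fun z => \sum_(i < n) g i z).
Proof.
move=> g_cont z; rewrite /continuous_at.
elim: (index_enum 'I_n) => [|i s IH].
  rewrite big_nil; under eq_fun do rewrite big_nil; exact: cvg_cst.
rewrite big_cons; under eq_fun do rewrite big_cons.
by apply: cvgD IH; exact: g_cont.
Qed.

Section Projection.
Context {R : realType} {H : normedModType R}.
Context (ip : {dot H for idfun}).
Context (ip_norm : forall x : H, ip x x = `|x| ^+ 2).
Context {K : set H}.
Implicit Types (x y u p w : H).

Lemma ipC x y : ip x y = ip y x.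
Proof. by rewrite hermC mul1r. Qed.

Lemma ip_suml (n : nat) (rho : 'I_n -> R) (k : 'I_n -> H) y :
  ip (\sum_(i < n) rho i *: k i) y = \sum_(i < n) rho i * ip (k i) y.
Proof. by rewrite linear_sumlz; apply: eq_bigr => i _; rewrite linearZl_LR. Qed.

Lemma sqr_normD x y : `|x + y| ^+ 2 = `|x| ^+ 2 + 2 * ip x y + `|y| ^+ 2.
Proof. by rewrite -!ip_norm linearDl !linearDr/= (ipC y x); ring. Qed.

(** Polarization carries the continuity of the norm, and bounds on norms, over to
the inner product. *)
Lemma ip_polarization x y : ip x y = (`|x + y| ^+ 2 - `|x| ^+ 2 - `|y| ^+ 2) / 2.
Proof. by rewrite sqr_normD; field. Qed.

Lemma continuous_ipl y : continuous (ip ^~ y).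
Proof.
have -> : ip ^~ y = fun x => (`|x + y| ^+ 2 - `|x| ^+ 2 - `|y| ^+ 2) / 2.
  by apply/funext => x; exact: ip_polarization.
move=> x; rewrite /continuous_at.
have normX (z : H) : `|u + z| ^+ 2 @[u --> x] --> `|x + z| ^+ 2.
  by apply: cvgM; apply: cvg_norm; apply: cvgD; [exact: cvg_id|exact: cvg_cst|
    exact: cvg_id|exact: cvg_cst].
apply: cvgM; last exact: cvg_cst.
apply: cvgB; last exact: cvg_cst.
by apply: cvgB => //; have := normX 0; rewrite addr0; under eq_fun do rewrite addr0.
Qed.

(** First order optimality: if [ip p u] were negative, then for small [t > 0] the
term [2 * t * ip p u] of [`|p + t *: u| ^+ 2 - `|p| ^+ 2] would outweigh the
quadratic one. *)
Lemma ip_ge0_of_norm_min p u :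
  (forall t : R, 0 <= t <= 1 -> `|p| <= `|p + t *: u|) -> 0 <= ip p u.
Proof.
move=> p_min; rewrite leNgt; apply/negP => a_lt0.
set a := ip p u in a_lt0; pose q := `|u| ^+ 2.
have q_ge0 : 0 <= q by rewrite sqr_ge0.
have qa_gt0 : 0 < q - a by lra.
(* This step lies in ]0, 1] and satisfies [t * q <= - a], so that
   [2 * a + t * q <= a < 0]. *)
pose t := - a / (q - a).
have t_gt0 : 0 < t by rewrite divr_gt0// oppr_gt0.
have tqa : t * (q - a) = - a by rewrite divfK// gt_eqF.
have t_le1 : t <= 1 by rewrite ler_pdivrMr//; lra.
have := p_min t; rewrite ltW//= t_le1 => /(_ isT).
rewrite -ler_sqr ?nnegrE// sqr_normD linearZr_LR /= normrZ exprMn -/a -/q.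
rewrite real_normK ?num_real//.
suff : t * (2 * a + t * q) < 0 by rewrite mulrDr; nra.
by rewrite pmulr_rlt0//; nra.
Qed.

(** * The nearest point of a conic hull *)

(** Combinations [w] with [`|x + w| <= `|x|] satisfy
[`|w + e| <= 2 * `|x| + `|e|], so polarization bounds [ip w e], and each
coefficient is at most [ip w e / d] with [d] the minimum of [ip k e] on [K].
The other combinations are no better than [w = 0].  Hence a minimum over
coefficients in [`[0, M]] is global; Tychonoff's theorem makes that set of
parameters compact. *)
Lemma conic_comb_norm_min (e x : H) n :
  compact K -> (forall k, K k -> 0 < ip k e) -> K !=set0 ->
  exists2 w, conic_comb K n w &
    forall w', conic_comb K n w' -> `|x + w| <= `|x + w'|.
Proof.
move=> K_compact e_pos K_neq0.
have [k0 /set_mem Kk0 k0_min] := compact_EVT_min K_neq0 K_compact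
  (continuous_subspaceT (continuous_ipl e)).
pose d := ip k0 e; have d_gt0 : 0 < d := e_pos _ Kk0.
pose M := (2 * `|x| + `|e|) ^+ 2 / 2 / d.
have M_ge0 : 0 <= M by rewrite !divr_ge0 ?sqr_ge0// ltW.
pose comb (f : 'I_n -> R * H) : H := \sum_(i < n) (f i).1 *: (f i).2.
pose P := prod_topology (fun _ : 'I_n => (R * H)%type).
pose A := [set f : P |
  forall i, (`[0, M] `*` K) (f i)].
have A_compact : compact A.
  apply: (@tychonoff _ (fun=> (R * H)%type) (fun=> `[0, M] `*` K)) => i.
  by apply: compact_setX => //; exact: segment_compact.
have A0 : (A : set P) (fun=> (0, k0)) by move=> i; split; rewrite //= in_itv /= lexx.
have A_neq0 : A !=set0 by exists (fun=> (0, k0)).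
have comb_cont : continuous (comb : P -> H).
  have term_cont i :
      continuous ((fun p : R * H => p.1 *: p.2) \o (proj i : P -> R * H)).
    move=> f; apply: continuous_comp; first exact: proj_continuous.
    exact: scale_continuous.
  exact: continuous_sum_ord term_cont.
have norm_cont : continuous ((fun u : H => `|x + u|) \o (comb : P -> H)).
  move=> f; apply: continuous_comp; first exact: comb_cont.
  by apply: cvg_norm; apply: cvgD; [exact: cvg_cst|exact: cvg_id].
have [f /set_mem Af f_min] := compact_EVT_min
  A_neq0 A_compact (continuous_subspaceT norm_cont).
exists (comb f).
  exists (fun i => (f i).1), (fun i => (f i).2); split=> // i.
  by have [/=] := Af i; rewrite in_itv /= => /andP[].
move=> _ [rho [k [rhok ->]]].
set w := \sum_(i < n) _.
have [xw|/ltW xw] := leP `|x + w| `|x|; last first.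
  apply: le_trans xw; have := f_min _ (mem_set A0).
  have comb0 : comb (fun=> (0, k0)) = 0.
    by rewrite /comb big1// => i _; exact: scale0r.
  by rewrite /= comb0 addr0.
apply: (f_min (fun i => (rho i, k i))); apply/mem_set => i.
split; last exact: (rhok i).2.
rewrite /= in_itv /= (rhok i).1 /= ler_pdivlMr//.
have w_le : ip w e <= (2 * `|x| + `|e|) ^+ 2 / 2.
  have we : `|w + e| ^+ 2 <= (2 * `|x| + `|e|) ^+ 2.
    rewrite ler_sqr ?nnegrE ?addr_ge0 ?mulr_ge0//.
    rewrite (le_trans (ler_normD _ _))// lerD2r.
    have -> : w = (x + w) - x by rewrite addrC addKr.
    rewrite (le_trans (ler_normB _ _))//; lra.
  rewrite (ip_polarization w e) ler_pM2r ?invr_gt0//.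
  have := sqr_ge0 `|w|; have := sqr_ge0 `|e|; lra.
apply: le_trans w_le; rewrite ip_suml (bigD1 i)//= -[leLHS]addr0 lerD//.
  by rewrite ler_wpM2l ?(rhok i).1//; apply: k0_min; apply/mem_set; exact: (rhok i).2.
apply: sumr_ge0 => j _; have [rhoj Kkj] := rhok j.
by rewrite mulr_ge0// ltW// e_pos.
Qed.

(** The hull contains [w + t *: k] for [k] in [K] and [t >= 0], and [(1 - t) *: w]
for [t <= 1].  Optimality along the first direction gives the inequality on
[K], hence [0 <= ip w (x + w)]; along the second it gives the reverse
inequality. *)
Lemma conic_hull_min_dual x w :
  conic_hull K w -> (forall w', conic_hull K w' -> `|x + w| <= `|x + w'|) ->
  (forall k, K k -> 0 <= ip k (x + w)) /\ ip w (x + w) = 0.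
Proof.
move=> [n _ wn] w_min.
have dual k : K k -> 0 <= ip k (x + w).
  move=> Kk; rewrite ipC; apply: ip_ge0_of_norm_min => t /andP[t_ge0 _].
  by rewrite -addrA; apply: w_min; exists n.+1 => //; exact: conic_combD.
split=> //; apply/eqP; rewrite eq_le; apply/andP; split.
  rewrite -oppr_ge0 -linearNl /= ipC; apply: ip_ge0_of_norm_min => t /andP[_ t_le1].
  have -> : x + w + t *: - w = x + (1 - t) *: w.
    by rewrite scalerBl scale1r scalerN addrA.
  by apply: w_min; exists n => //; apply: conic_combZ => //; rewrite subr_ge0.
have [rho [k [rhok {1}->]]] := wn; rewrite ip_suml.
by apply: sumr_ge0 => i _; have [rho_ge0 Kk] := rhok i; rewrite mulr_ge0 ?dual.
Qed.

(** By Carathéodory and the dimension bound, a minimiser among the combinations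
with [n] terms is a minimiser over the whole hull; a second application
of Carathéodory makes its terms independent with positive coefficients. *)
Lemma exists_conic_complement (e x : H) n :
  compact K -> (forall k, K k -> 0 < ip k e) -> has_dim K n -> K !=set0 ->
  exists m (rho : 'I_m -> R) (k : 'I_m -> H),
    let p := x + \sum_(i < m) rho i *: k i in
    [/\ neg_polar_cone ip K p, (m <= n)%N, forall i, 0 < rho i /\ K (k i),
        lin_indep_family k & forall i, ip (k i) p = 0].
Proof.
move=> K_compact e_pos K_dim K_neq0.
have [w wn w_min] := conic_comb_norm_min e x n K_compact e_pos K_neq0.
have hull_n z : conic_hull K z -> conic_comb K n z.
  move=> /caratheodory[m [rho [k [rhok k_indep ->]]]].
  apply: (conic_comb_widen K m) => //.
    by apply: (has_dim_leq K_dim k_indep) => i; exact: (rhok i).2.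
  by exists rho, k; split=> // i; have [/ltW] := rhok i.
have w_hull : conic_hull K w by exists n.
have [dual wp] := conic_hull_min_dual x w w_hull (fun z zK => w_min z (hull_n z zK)).
have [m [rho [k [rhok k_indep wE]]]] := caratheodory K w w_hull.
exists m, rho, k; rewrite /= -wE; split=> //.
- by rewrite neg_polar_coneE => l Kl; rewrite ipC; exact: dual.
- by apply: (has_dim_leq K_dim k_indep) => i; exact: (rhok i).2.
(* A vanishing sum of nonnegative terms [rho i * ip (k i) p]. *)
move: wp; rewrite {1}wE ip_suml => /eqP; rewrite psumr_eq0 => [|i _]; last first.
  by have [/ltW rho_ge0 Kk] := rhok i; rewrite mulr_ge0 ?dual.
move=> /allP ort i; have := ort i (mem_index_enum i).
by rewrite /= mulf_eq0 gt_eqF ?(rhok i).1// => /eqP.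
Qed.

(** * Characterization of the metric projection *)

(** The obtuse angle between [x - p] and [y - p] gives
[`|x - p| ^+ 2 + `|y - p| ^+ 2 <= `|x - y| ^+ 2] on the cone, hence both that [p]
is a nearest point and that it is the only one. *)
Lemma metric_proj_conic_complement x p m (rho : 'I_m -> R) (k : 'I_m -> H) :
  neg_polar_cone ip K p -> p = x + \sum_(i < m) rho i *: k i ->
  (forall i, 0 <= rho i /\ K (k i)) -> (forall i, ip (k i) p = 0) ->
  metric_proj (neg_polar_cone ip K) x = p.
Proof.
move=> Cp pE rhok kp.
have pythagoras y : neg_polar_cone ip K y ->
    `|x - p| ^+ 2 + `|y - p| ^+ 2 <= `|x - y| ^+ 2.
  rewrite neg_polar_coneE => Cy.
  rewrite -(distrC p y) -[x - y](subrKA p) (sqr_normD (x - p)) -addrA lerD2l lerDr.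
  rewrite mulr_ge0// {1}pE opprD addNKr linearNl linearBr /= oppr_ge0.
  rewrite subr_le0 !ip_suml; apply: ler_sum => i _.
  have [rho_ge0 Kk] := rhok i.
  by rewrite kp mulr0 mulr_ge0// ipC; exact: Cy.
apply: xget_unique => [|y [Cy y_min]].
  split=> // y Cy; rewrite -ler_sqr ?nnegrE//.
  by apply: le_trans (pythagoras y Cy); rewrite lerDl sqr_ge0.
have := y_min p Cp; rewrite -ler_sqr ?nnegrE// => yp.
have := le_trans (pythagoras y Cy) yp; rewrite gerDl => yp0.
have : `|y - p| ^+ 2 == 0 by rewrite eq_le yp0 sqr_ge0.
by rewrite sqrf_eq0 normr_eq0 subr_eq0 => /eqP.
Qed.

(** Pairing a linear relation with [p] isolates the coefficient of [p]. *)
Lemma lin_indep_family_orthogonal {m} (k : 'I_m -> H) p :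
  lin_indep_family k -> (forall i, ip (k i) p = 0) -> p != 0 ->
  lin_indep_family (fun i : 'I_m.+1 => oapp k p (unlift ord0 i)).
Proof.
move=> k_indep kp p0 c; rewrite big_ord_recl unlift_none /=.
under eq_bigr do rewrite liftK /=.
move=> ck0.
have c0 : c ord0 = 0.
  have := congr1 (ip ^~ p) ck0; rewrite linearDl linearZl_LR /= linear0l ip_suml.
  rewrite big1 => [|i _]; last by rewrite kp mulr0.
  by rewrite addr0 ip_norm => /eqP; rewrite mulf_eq0 sqrf_eq0 normr_eq0 (negPf p0) orbF
    => /eqP.
move: ck0; rewrite c0 scale0r add0r => /k_indep ck i.
by have [j ->|->//] := unliftP ord0 i; exact: ck.
Qed.

End Projection.

Theorem theorem3p9 (R : realType) (H : completeNormedModType R)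
    (ip : {dot H for idfun}) (ip_norm : forall x : H, ip x x = `|x| ^+ 2)
    (K : set H) (K_compact : compact K)
    (e : H) (e_pos : forall k, K k -> 0 < ip k e)
    (n : nat) (K_dim : has_dim K n)
    (x x0 : H) (xNC : ~ neg_polar_cone ip K x)
    (x0C : neg_polar_cone ip K x0) :
  let representation (m : nat) (rho : 'I_m -> R) (k : 'I_m -> H) : Prop :=
    [/\ x0 = x + \sum_(i < m) rho i *: k i,
        (1 <= m)%N,
        forall i, 0 < rho i /\ K (k i),
        lin_indep_family k &
        forall i, ip (k i) x0 = 0] in
  (x0 = metric_proj (neg_polar_cone ip K) x <->
   exists (m : nat) (rho : 'I_m -> R) (k : 'I_m -> H),
     (m <= n)%N /\ representation m rho k) /\
  (has_dim [set: H] n -> x0 != 0 ->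
   forall (m : nat) (rho : 'I_m -> R) (k : 'I_m -> H),
     representation m rho k -> (m <= n.-1)%N).
Proof.
move=> representation; split; last first.
  move=> H_dim x0_neq0 m rho k [_ _ _ k_indep kx0].
  have kx0_indep := lin_indep_family_orthogonal ip ip_norm k x0 k_indep kx0 x0_neq0.
  have : (m.+1 <= n)%N by exact: (has_dim_leq H_dim kx0_indep).
  by case: (n).
split=> [x0P|[m [rho [k [_ [x0E _ rhok _ kx0]]]]]]; last first.
  apply/esym; apply: (metric_proj_conic_complement ip ip_norm x x0 m rho k) => // i.
  by have [/ltW] := rhok i.
(* An empty [K] would make [C] the whole space, which contains [x]. *)
have K_neq0 : K !=set0.
  apply: contrapT => K0; apply: xNC; rewrite neg_polar_coneE => k Kk.
  by case: K0; exists k.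
have [m [rho [k [Cp mn rhok k_indep kp]]]] :=
  exists_conic_complement ip ip_norm e x n K_compact e_pos K_dim K_neq0.
exists m, rho, k; split=> //; rewrite /representation.
have -> : x0 = x + \sum_(i < m) rho i *: k i.
  rewrite x0P.
  apply: (metric_proj_conic_complement ip ip_norm x _ m rho k) => // i.
  by have [/ltW] := rhok i.
split=> //.
(* Without any term the nearest point would be [x] itself, which is not in [C]. *)
case: m => [|//] in rho k Cp {mn rhok k_indep kp} *.
by move: Cp; rewrite big_ord0 addr0.
Qed.
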